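(* Let $X,Y,Z$ be real locally convex topological vector spaces and let $F\colon X\rightrightarrows Y$ and $G\colon Y\rightrightarrows Z$ be convex set-valued mappings. Suppose that one of the following two conditions holds: (a) $F$ is polyhedral and there exists a triple $(\hat x,\hat y,\hat z)\in X\times Y\times Z$ satisfying $(\hat x,\hat y)\in\mathrm{gph}(F)$ and $(\hat y,\hat z)\in\mathrm{qri}(\mathrm{gph}(G))$; (b) $G$ is polyhedral and there exists a triple $(\hat x,\hat y,\hat z)\in X\times Y\times Z$ satisfying $(\hat x,\hat y)\in\mathrm{qri}(\mathrm{gph}(F))$ and $(\hat y,\hat z)\in\mathrm{gph}(G)$. Then for any $(\bar x,\bar z)\in\mathrm{gph}(G\circ F)$ and $z^*\in Z^*$ we have $$D^*(G\circ F)(\bar x,\bar z)(z^* )=D^*F(\bar x,\bar y)\circ D^*G(\bar y,\bar z)(z^* )\quad\text{whenever }\bar y\in M(\bar x,\bar z):=F(\bar x)\cap G^{-1}(\bar z).$$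
   Context: For a set-valued mapping $F\colon X\rightrightarrows Y$, $\mathrm{gph}(F):=\{(x,y)\mid y\in F(x)\}$; $F$ is convex if $\mathrm{gph}(F)$ is a convex subset of $X\times Y$. $G^{-1}(z):=\{y\mid z\in G(y)\}$. The composition is $(G\circ F)(x):=\bigcup_{y\in F(x)}G(y)$; in particular $D^*F(\bar x,\bar y)\circ D^*G(\bar y,\bar z)(z^* )=\bigcup_{y^*\in D^*G(\bar y,\bar z)(z^* )}D^*F(\bar x,\bar y)(y^* )$. A subset $P$ of a locally convex space $W$ is a convex polyhedron if $P=\{w\in W\mid\langle w_i^*,w\rangle\le\alpha_i,\ i=1,\dots,k\}$ for finitely many $w_i^*\in W^*$, $\alpha_i\in\mathbb{R}$; a set-valued mapping is polyhedral if its graph is a convex polyhedron in the product space. For a convex set $\Omega$, $\mathrm{qri}(\Omega):=\{x\in\Omega\mid\overline{\mathrm{cone}(\Omega-x)}\text{ is a linear subspace}\}$, where $\mathrm{cone}(A):=\{ta\mid t\ge0,\ a\in A\}$. The normal cone to a convex set $\Omega$ at $\bar x\in\Omega$ is $N(\bar x;\Omega):=\{x^*\mid\langle x^*,x-\bar x\rangle\le0\text{ for all }x\in\Omega\}$. For $(\bar x,\bar y)\in\mathrm{gph}(F)$, the coderivative is $D^*F(\bar x,\bar y)(y^* ):=\{x^*\in X^*\mid(x^*,-y^* )\in N((\bar x,\bar y);\mathrm{gph}(F))\}$ for $y^*\in Y^*$. *)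

(* Defs.v *)
From HB Require Import structures.
From mathcomp Require Import all_boot all_order all_algebra.
From mathcomp Require Import all_classical all_reals all_analysis.

Set Implicit Arguments.
Unset Strict Implicit.
Unset Printing Implicit Defensive.

Import Order.TTheory GRing.Theory Num.Theory.
Import numFieldNormedType.Exports.

Local Open Scope classical_set_scope.
Local Open Scope ring_scope.

(* The topological dual.  The library's [tvsType] is a *locally convex*
   topological vector space, not assumed Hausdorff. *)
Record dual (R : realType) (W : tvsType R) := Dual {
  dual_fun :> {linear W -> R^o} ;
  dual_continuous : continuous dual_fun }.

Section DualOperations.
Context {R : realType} {X Y : tvsType R}.

Definition dual_opp_fun (f : dual X) (x : X) : R^o := - f x.

Fact dual_opp_linear f : linear (dual_opp_fun f).
Proof. by move=> a u v; rewrite /dual_opp_fun linearP opprD scalerN. Qed.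

HB.instance Definition _ f :=
  GRing.isLinear.Build R X R^o _ (dual_opp_fun f) (dual_opp_linear f).

Fact dual_opp_continuous f : continuous (dual_opp_fun f).
Proof. by move=> x; apply: cvgN; exact: (dual_continuous (d := f)). Qed.

Definition dual_opp (f : dual X) : dual X := Dual (@dual_opp_continuous f).

Definition dual_pair_fun (f : dual X) (g : dual Y) (w : X * Y) : R^o :=
  f w.1 + g w.2.

Fact dual_pair_linear f g : linear (dual_pair_fun f g).
Proof.
by move=> a u v; rewrite /dual_pair_fun /= !linearP /= scalerDr addrACA.
Qed.

HB.instance Definition _ f g := GRing.isLinear.Build R (X * Y)%type R^o _
  (dual_pair_fun f g) (dual_pair_linear f g).

Fact dual_pair_continuous f g : continuous (dual_pair_fun f g).
Proof.
move=> w; apply: cvgD.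
  apply: (@continuous_comp _ _ _ fst f); first exact: cvg_fst.
  exact: (dual_continuous (d := f)).
apply: (@continuous_comp _ _ _ snd g); first exact: cvg_snd.
exact: (dual_continuous (d := g)).
Qed.

(* The identification of the dual of [X * Y] with the product of the duals:
   the pair (f, g) acts by <(f, g), (x, y)> = <f, x> + <g, y>. *)
Definition dual_pair (f : dual X) (g : dual Y) : dual (X * Y)%type :=
  Dual (@dual_pair_continuous f g).

End DualOperations.

Section ConvexSets.
Context {R : realType} {W : tvsType R}.

Definition convex_polyhedron (P : set W) : Prop :=
  exists (k : nat) (w : 'I_k -> dual W) (alpha : 'I_k -> R),
    P = [set v | forall i, w i v <= alpha i].

Definition cone (A : set W) : set W :=
  [set w | exists2 t : R, 0 <= t & exists2 a, A a & w = t *: a].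

Definition qri (Omega : set W) : set W :=
  [set x | Omega x /\
    GRing.submod_closed [in closure (cone [set w - x | w in Omega])]].

(* Total in [x]; the notion is only meant for [x] in a convex [Omega]. *)
Definition normal_cone (x : W) (Omega : set W) : set (dual W) :=
  [set f | forall w, Omega w -> f (w - x) <= 0].

End ConvexSets.

Section SetValuedMappings.
Context {S T U : Type}.

Definition gph (F : S -> set T) : set (S * T) := [set p | F p.1 p.2].

Definition sv_inv (F : S -> set T) : T -> set S := fun y => [set x | F x y].

Definition sv_comp (G : T -> set U) (F : S -> set T) : S -> set U :=
  fun x => \bigcup_(y in F x) G y.

End SetValuedMappings.

Section ConvexSetValuedMappings.
Context {R : realType} {X Y : tvsType R}.

Definition sv_convex (F : X -> set Y) : Prop := convex_set (gph F).

Definition sv_polyhedral (F : X -> set Y) : Prop := convex_polyhedron (gph F).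

(* Total in [(x, y)]; the notion is only meant for points of [gph F]. *)
Definition coderivative (F : X -> set Y) (x : X) (y : Y) :
    dual Y -> set (dual X) :=
  fun ystar =>
    [set xstar | normal_cone (x, y) (gph F) (dual_pair xstar (dual_opp ystar))].

End ConvexSetValuedMappings.

(* Main.v *)
Require Import Defs.
From HB Require Import structures.
From mathcomp Require Import all_boot all_order all_algebra.
From mathcomp Require Import all_classical all_reals all_analysis.
From mathcomp Require Import ring lra.

Set Implicit Arguments.
Unset Strict Implicit.
Unset Printing Implicit Defensive.

Import Order.TTheory GRing.Theory Num.Theory.
Import numFieldNormedType.Exports.

Local Open Scope classical_set_scope.
Local Open Scope ring_scope.

(** In W = X * Y * Z let A be the cylinder over gph F and B the cylinder over
    gph G.  A functional xs belongs to D*(G o F)(zs) exactly when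
    (x, y, z) |-> <xs, x> - <zs, z> is normal to A `&` B, and it belongs to
    D*F(ys) for some ys in D*G(zs) exactly when that functional is a sum
    h1 + h2 with h1 normal to A and h2 normal to B: cylinders force h1 to ignore
    z and h2 to ignore x, so ys is read off as h2 restricted to Y
    ([coderivative_comp_split]).  One inclusion is thus immediate and the other
    is the intersection rule N(w; P `&` C) = N(w; P) + N(w; C), for P a convex
    polyhedron that contains a quasi-relative interior point of the convex
    set C ([normal_cone_polyhedronI]).

    That rule rests on one consequence of w0 in qri C, namely that the normal
    cone at w0 is flat: a functional that attains its maximum over C at w0 is
    constant on C ([qri_flat_normal_cone]).  What remains is a Farkas lemma
    ([farkas_flat]): if g <= b on the intersection of C with finitely many
    half-spaces, some h <= c implied by the half-spaces satisfies
    g - h <= b - c on C.  It goes by induction on the half-spaces.  A half-space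
    {f <= a} whose removal keeps g <= b is discarded.  Otherwise a point w1 of C
    satisfies all other constraints but has g > b, hence f > a.  Sliding w0
    towards w1 until f = a keeps flatness, and the slice of C by {f = a} is
    again flat there, so the induction hypothesis applies to the slice.  A
    single equality constraint has a multiplier mu of unknown sign
    ([lagrange_equality], a supremum of slopes), and the violating point w1
    forces mu >= 0. *)

(** * Continuous functionals *)

Section DualArithmetic.
Context {R : realType}.

Section Combination.
Context {W : tvsType R} (a : R) (f g : dual W).

Definition dual_comb_fun (w : W) : R^o := f w + a * g w.

Fact dual_comb_linear : linear dual_comb_fun.
Proof.
move=> c u v; rewrite /dual_comb_fun !linearP /= scalerDr.
rewrite mulrDr addrACA; congr (_ + _ + _).
by rewrite /GRing.scale /= mulrCA.
Qed.

HB.instance Definition _ :=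
  GRing.isLinear.Build R W R^o _ dual_comb_fun dual_comb_linear.

Fact dual_comb_continuous : continuous dual_comb_fun.
Proof.
move=> w; apply: cvgD; first exact: (dual_continuous (d := f)).
by apply: cvgM; [exact: cvg_cst|exact: (dual_continuous (d := g))].
Qed.

Definition dual_comb : dual W := Dual dual_comb_continuous.
End Combination.

Section Pullback.
Context {V W : tvsType R} {L : V -> W}.
Context (L_lin : linear L) (L_cont : continuous L) (f : dual W).

Definition dual_pull_fun (v : V) : R^o := f (L v).

Fact dual_pull_linear : linear dual_pull_fun.
Proof. by move=> c u v; rewrite /dual_pull_fun L_lin linearP. Qed.

HB.instance Definition _ :=
  GRing.isLinear.Build R V R^o _ dual_pull_fun dual_pull_linear.

Fact dual_pull_continuous : continuous dual_pull_fun.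
Proof.
move=> v; apply: (@continuous_comp _ _ _ L f); first exact: L_cont.
exact: (dual_continuous (d := f)).
Qed.

Definition dual_pull : dual V := Dual dual_pull_continuous.
End Pullback.

End DualArithmetic.

Section Evaluation.
Context {R : realType} {W : tvsType R}.
Implicit Types (f g h : dual W) (C : set W).

(** The value of a functional as an element of R instead of R^o: [ring] and
    [lra] then recognise the operations applied to it. *)
Definition ev f (w : W) : R := f w.

Lemma ev0 f : ev f 0 = 0. Proof. exact: linear0. Qed.
Lemma evD f x y : ev f (x + y) = ev f x + ev f y. Proof. exact: linearD. Qed.
Lemma evB f x y : ev f (x - y) = ev f x - ev f y. Proof. exact: linearB. Qed.
Lemma evZ f a x : ev f (a *: x) = a * ev f x. Proof. exact: linearZ. Qed.

Lemma ev_comb a f g w : ev (dual_comb a f g) w = ev f w + a * ev g w.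
Proof. by []. Qed.

Lemma ev_opp f w : ev (dual_opp f) w = - ev f w. Proof. by []. Qed.

Lemma normal_coneP w0 C h :
  normal_cone w0 C h <-> forall w, C w -> ev h w <= ev h w0.
Proof.
have hE w : ((h (w - w0) : R) <= 0) = (ev h w <= ev h w0).
  by rewrite -[h _]/(ev h (w - w0)) evB subr_le0.
by split=> hC w /hC; rewrite hE.
Qed.

End Evaluation.

(** * Convex sets and flat normal cones *)

Section Flatness.
Context {R : realType} {W : tvsType R}.
Implicit Types (C : set W) (f g h : dual W) (x y w : W).

Definition flat_normal_cone C (w0 : W) :=
  forall h, normal_cone w0 C h -> forall w, C w -> ev h w = ev h w0.

(** A normal functional is nonpositive on the closed cone generated by C - w0,
    hence zero there as soon as that cone is a linear subspace. *)
Lemma qri_flat_normal_cone C w0 : qri C w0 -> flat_normal_cone C w0.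
Proof.
move=> [Cw0 [K0 Klin]] h hC.
have hK u : u \in closure (cone [set w - w0 | w in C]) -> ev h u <= 0.
  have clN : closed [set v | ev h v <= 0].
    apply: (@preimage_closed _ _ h [set r : R^o| r <= 0]).
      by move=> v _; exact: (dual_continuous (d := h)).
    exact: closed_le.
  rewrite inE => Ku; suff: [set v | ev h v <= 0] u by [].
  rewrite ((closure_id _).1 clN); apply: closureS Ku.
  move=> _ [t t0 [_ [w Cw <-] ->]] /=; rewrite evZ mulr_ge0_le0//.
  exact: hC.
move=> w Cw.
have Kw : w - w0 \in closure (cone [set w - w0 | w in C]).
  rewrite inE; apply: subset_closure; exists 1 => //.
  by exists (w - w0); [exists w|rewrite scale1r].
apply/eqP; rewrite eq_le (proj1 (normal_coneP _ _ _) hC)//=.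
have := hK _ (Klin (-1) _ _ Kw K0).
by rewrite addr0 scaleN1r opprB evB subr_le0.
Qed.

Lemma convex_setP C : convex_set C <->
  forall x y (t : R), C x -> C y -> 0 <= t -> t <= 1 ->
    C (t *: x + (1 - t) *: y).
Proof.
split=> [cC x y t Cx Cy t0 t1|cC x y l].
  by have := cC x y (Itv01 t0 t1); rewrite !inE; apply.
by rewrite !inE => Cx Cy; apply: cC.
Qed.

(** The multiplier is a common bound for the slopes (g - b) / (f - a): those on
    the side f > a stay below those on the side f < a, because the segment that
    joins two points on opposite sides meets {f = a}, where g <= b. *)
Lemma lagrange_equality C f (a : R) g (b : R) : convex_set C ->
    (exists2 w, C w & ev f w < a) -> (exists2 w, C w & a < ev f w) ->
    (forall w, C w -> ev f w = a -> ev g w <= b) ->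
  exists mu : R, forall w, C w -> ev g w - b <= mu * (ev f w - a).
Proof.
move=> cC [n Cn fn] [p Cp fp] gb.
have ratio x y : C x -> a < ev f x -> C y -> ev f y < a ->
    (ev g x - b) / (ev f x - a) <= (ev g y - b) / (ev f y - a).
  move=> Cx fx Cy fy.
  have d0 : 0 < ev f x - ev f y by rewrite subr_gt0 (lt_trans fy).
  set t := (a - ev f y) / (ev f x - ev f y).
  have tE : t * (ev f x - ev f y) = a - ev f y by rewrite /t divfK// gt_eqF.
  have t0 : 0 <= t by rewrite divr_ge0 ?(ltW d0)// subr_ge0 ltW.
  have t1 : t <= 1 by rewrite ler_pdivrMr// mul1r lerD2r ltW.
  have := gb _ (proj1 (convex_setP C) cC _ _ _ Cx Cy t0 t1).
  rewrite !evD !evZ.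
  (* t is the parameter at which the segment from y to x meets {f = a} *)
  have -> : t * ev f x + (1 - t) * ev f y = a.
    by rewrite -[RHS](subrK (ev f y)) -tE; ring.
  move=> /(_ erefl); rewrite -(ler_pM2l d0).
  have -> : (ev f x - ev f y) * (t * ev g x + (1 - t) * ev g y) =
      (t * (ev f x - ev f y)) * ev g x
      + (ev f x - ev f y - t * (ev f x - ev f y)) * ev g y by ring.
  rewrite tE ler_pdivrMr ?subr_gt0// mulrAC ler_ndivlMr ?subr_lt0//; lra.
have [mu [mu_ge mu_le]] : exists mu : R,
    (forall x, C x -> a < ev f x -> (ev g x - b) / (ev f x - a) <= mu) /\
    (forall y, C y -> ev f y < a -> mu <= (ev g y - b) / (ev f y - a)).
  pose E := [set (ev g x - b) / (ev f x - a) |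
    x in [set x | C x /\ a < ev f x]].
  exists (sup E); split=> [x Cx fx|y Cy fy].
    apply: ub_le_sup; last by exists x.
    by exists ((ev g n - b) / (ev f n - a)) => _ [z [Cz fz] <-]; exact: ratio.
  apply: ge_sup; first by exists ((ev g p - b) / (ev f p - a)), p.
  by move=> _ [z [Cz fz] <-]; exact: ratio.
exists mu => w Cw.
have [fw|fw|fw] := ltgtP (ev f w) a.
- by rewrite -ler_ndivlMr ?subr_lt0// mu_le.
- by rewrite -ler_pdivrMr ?subr_gt0// mu_ge.
- by rewrite fw subrr mulr0 subr_le0 gb.
Qed.

(** If h is maximal over C at an interior point of the segment from w0 to w1,
    being affine on it, it takes the same value at w0, where flatness
    applies. *)
Lemma flat_normal_cone_segment C w0 w1 (t : R) :
    flat_normal_cone C w0 -> C w0 -> C w1 -> 0 <= t -> t < 1 ->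
  flat_normal_cone C (t *: w1 + (1 - t) *: w0).
Proof.
move=> flat Cw0 Cw1 t0 t1 h /normal_coneP.
rewrite evD !evZ => hC w Cw.
have hw : forall w, C w -> ev h w = ev h w0.
  apply: flat; apply/normal_coneP => v /hC hv; apply: le_trans hv _.
  have := hC _ Cw1.
  have s0 : 0 < 1 - t by rewrite subr_gt0.
  move=> h1; have : (1 - t) * ev h w1 <= (1 - t) * ev h w0 by lra.
  rewrite ler_pM2l// => h10.
  have : t * ev h w1 <= t * ev h w0 by rewrite ler_wpM2l.
  by lra.
by rewrite (hw w)// (hw w1)//; ring.
Qed.

(** For h maximal at w0 over the slice, a multiplier mu turns h - mu * f into a
    functional maximal at w0 over all of C, hence constant on C; on the slice
    this says that h is constant. *)
Lemma flat_normal_cone_slice C f (a : R) w0 : convex_set C ->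
    (exists2 w, C w & ev f w < a) -> (exists2 w, C w & a < ev f w) ->
    flat_normal_cone C w0 -> ev f w0 = a ->
  flat_normal_cone (C `&` [set w | ev f w = a]) w0.
Proof.
move=> cC fN fP flat fw0 h /normal_coneP hC.
have [mu hmu] := lagrange_equality cC fN fP (fun w Cw fw => hC w (conj Cw fw)).
move=> w [Cw /= fw].
have := flat (dual_comb (- mu) h f) _ w Cw.
rewrite !ev_comb fw fw0 => H; apply: (addIr (- mu * a)); apply: H.
apply/normal_coneP => v Cv; rewrite !ev_comb fw0.
by have := hmu v Cv; lra.
Qed.

(** Polyhedra as lists of constraints, for inductions that remove constraints
    one at a time. *)
Definition halfspaces (s : seq (dual W * R)) : set W :=
  foldr (fun p P => [set w | ev p.1 w <= p.2] `&` P) setT s.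

Lemma polyhedron_halfspaces (P : set W) :
  convex_polyhedron P -> exists s, P = halfspaces s.
Proof.
move=> [k [u [alpha ->]]]; exists [seq (u i, alpha i) | i <- enum 'I_k].
apply/seteqP; split=> w /= Pw.
  by elim: (enum _) => //= i r IH; split=> //=; exact: Pw.
move=> i; have : i \in enum 'I_k by rewrite mem_enum.
elim: (enum _) Pw => //= j r IH [Pj Pr]; rewrite inE => /predU1P[-> //|].
exact: IH.
Qed.

Lemma convex_slice C f (a : R) :
  convex_set C -> convex_set (C `&` [set w | ev f w = a]).
Proof.
move=> /convex_setP cC; apply/convex_setP => x y t [Cx /= fx] [Cy /= fy] t0 t1.
by split; [exact: cC|rewrite /= evD !evZ fx fy; ring].
Qed.

Lemma convex_halfspaces (s : seq (dual W * R)) : convex_set (halfspaces s).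
Proof.
apply/convex_setP => x y t sx sy t0 t1.
elim: s sx sy => //= -[f a] s IH [/= fx sx] [/= fy sy]; split; last exact: IH.
rewrite /= evD !evZ; have := ler_wpM2l t0 fx.
by have := ler_wpM2l (_ : 0 <= 1 - t) fy; rewrite subr_ge0 => /(_ t1); lra.
Qed.

End Flatness.

(** * The intersection rule for normal cones *)

Section IntersectionRule.
Context {R : realType} {W : tvsType R}.
Implicit Types (C : set W) (f g h : dual W) (x y w : W).

(** The pair (h, c) stands for a nonnegative combination of the constraints
    (f, a) in s; only the inequality h <= c that such a combination inherits is
    recorded.  Flatness at a feasible point replaces the Slater condition, so
    that constraints may be active at every feasible point. *)
Lemma farkas_flat (s : seq (dual W * R)) C w0 g (b : R) :
    convex_set C -> C w0 -> flat_normal_cone C w0 -> halfspaces s w0 ->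
    (forall w, C w -> halfspaces s w -> ev g w <= b) ->
  exists h (c : R), (forall w, halfspaces s w -> ev h w <= c) /\
    forall w, C w -> ev g w - ev h w <= b - c.
Proof.
elim: s C w0 => [|[f a] s IH] C w0 cC Cw0 flat /=.
  (* g - g is the zero functional *)
  move=> _ gb; exists (dual_comb (-1) g g), 0; split=> w.
    by rewrite ev_comb => _; lra.
  by rewrite ev_comb => /gb /(_ I); lra.
move=> [/= fw0 sw0] gb.
have [gb'|] := pselect (forall w, C w -> halfspaces s w -> ev g w <= b).
  have [h [c [hs hC]]] := IH C w0 cC Cw0 flat sw0 gb'.
  by exists h, c; split=> // w [_ /hs].
move=> /existsNP[w1 /not_implyP[Cw1 /not_implyP[sw1 /negP]]].
rewrite -ltNge => gw1.
have fw1 : a < ev f w1.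
  by rewrite ltNge; apply/negP => fw1; have := gb w1 Cw1 (conj fw1 sw1); lra.
(* v0 is the point of the segment from w0 to w1 where f = a; it differs from w1,
   which is what flatness at v0 requires *)
have [v0 [Cv0 flat_v0 sv0 fv0]] : exists v0,
    [/\ C v0, flat_normal_cone C v0, halfspaces s v0 & ev f v0 = a].
  have d0 : 0 < ev f w1 - ev f w0 by rewrite subr_gt0 (le_lt_trans fw0).
  pose t := (a - ev f w0) / (ev f w1 - ev f w0).
  have tE : t * (ev f w1 - ev f w0) = a - ev f w0 by rewrite /t divfK// gt_eqF.
  have t0 : 0 <= t by rewrite divr_ge0 ?(ltW d0)// subr_ge0.
  have t1 : t < 1 by rewrite ltr_pdivrMr// mul1r ltrD2r.
  exists (t *: w1 + (1 - t) *: w0); split.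
  - exact: (proj1 (convex_setP C) cC _ _ _ Cw1 Cw0 t0 (ltW t1)).
  - exact: flat_normal_cone_segment.
  - apply: (proj1 (convex_setP (halfspaces s))) => //; last exact: ltW.
    exact: convex_halfspaces.
  - by rewrite evD !evZ -[RHS](subrK (ev f w0)) -tE; ring.
have fP : exists2 w, C w & a < ev f w by exists w1.
(* otherwise v0 minimises f over C, and flatness makes f constant on C,
   against f v0 = a < f w1 *)
have fN : exists2 w, C w & ev f w < a.
  apply: contrapT => noN.
  have vN : normal_cone v0 C (dual_opp f).
    apply/normal_coneP => w Cw; rewrite !ev_opp fv0 lerN2 leNgt.
    by apply/negP => fw; apply: noN; exists w.
  by have := flat_v0 _ vN _ Cw1; rewrite !ev_opp; lra.
have [|||||h [c [hs hC]]] := IH (C `&` [set w | ev f w = a]) v0.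
- exact: convex_slice.
- by [].
- exact: flat_normal_cone_slice.
- by [].
- by move=> w [Cw /= fw] sw; apply: gb => //; split=> //=; rewrite fw.
have [mu gmu] : exists mu, forall w, C w ->
    ev (dual_comb (-1) g h) w - (b - c) <= mu * (ev f w - a).
  apply: lagrange_equality => // w Cw fw.
  by have := hC w (conj Cw fw); rewrite ev_comb; lra.
(* at w1 the left-hand side of gmu is positive, and so is f - a *)
have mu0 : 0 <= mu.
  rewrite -(pmulr_lge0 _ (_ : 0 < ev f w1 - a)) ?subr_gt0//.
  by have := gmu w1 Cw1; have := hs w1 sw1; rewrite ev_comb; lra.
exists (dual_comb mu h f), (c + mu * a); split=> w.
  move=> [/= fw /hs hw]; rewrite ev_comb lerD// ler_wpM2l//.
by move=> /gmu; rewrite !ev_comb; lra.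
Qed.

(** Farkas with b := g w makes h <= c and g - h <= b - c tight at w, so that h
    is normal to P and g - h is normal to C. *)
Lemma normal_cone_polyhedronI (P C : set W) w0 w g :
    convex_polyhedron P -> convex_set C ->
    P w0 -> C w0 -> flat_normal_cone C w0 -> P w -> C w ->
    normal_cone w (P `&` C) g ->
  exists h1 h2, [/\ normal_cone w P h1, normal_cone w C h2 &
    forall v, ev g v = ev h1 v + ev h2 v].
Proof.
move=> /polyhedron_halfspaces[s ->] cC sw0 Cw0 flat sw Cw /normal_coneP gw.
have [|h [c [hs hC]]] := @farkas_flat s C w0 g (ev g w) cC Cw0 flat sw0.
  by move=> v Cv sv; exact: gw.
have hw : ev h w = c.
  by apply/eqP; rewrite eq_le hs//=; have := hC w Cw; lra.
exists h, (dual_comb (-1) g h); split.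
- by apply/normal_coneP => v /hs; rewrite hw.
- by apply/normal_coneP => v /hC; rewrite !ev_comb hw; lra.
- by move=> v; rewrite ev_comb; lra.
Qed.

End IntersectionRule.

(** * Cylinders *)

Section Cylinder.
Context {R : realType} {V W : tvsType R} {L : W -> V} {S : V -> W}.
Context (L_lin : linear L) (L_cont : continuous L).
Context (S_lin : linear S) (S_cont : continuous S) (SK : cancel S L).
Implicit Types (Om : set V).

Let LD u v : L (u + v) = L u + L v.
Proof. by have := L_lin 1 u v; rewrite !scale1r. Qed.

Let L0 : L 0 = 0.
Proof. by have := L_lin (-1) 0 0; rewrite scaler0 addr0 scaleN1r addNr. Qed.

Let LZ a u : L (a *: u) = a *: L u.
Proof. by have := L_lin a u 0; rewrite L0 !addr0. Qed.

Lemma convex_preimage Om : convex_set Om -> convex_set (L @^-1` Om).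
Proof.
move=> /convex_setP cO; apply/convex_setP => x y t Ox Oy t0 t1.
by rewrite /preimage /= LD !LZ; exact: cO.
Qed.

Lemma convex_polyhedron_preimage Om :
  convex_polyhedron Om -> convex_polyhedron (L @^-1` Om).
Proof.
move=> [k [u [alpha ->]]].
by exists k, (fun i => dual_pull L_lin L_cont (u i)), alpha.
Qed.

(** A normal functional to a cylinder vanishes on the directions of ker L, along
    which the cylinder is invariant, and therefore factors through L.  The
    section S makes the factor h o S continuous. *)
Lemma normal_cone_preimage Om w0 (h : dual W) : Om (L w0) ->
    normal_cone w0 (L @^-1` Om) h ->
  normal_cone (L w0) Om (dual_pull S_lin S_cont h) /\
  forall w, ev h w = ev h (S (L w)).
Proof.
move=> Ow0 /normal_coneP hN.
have LN u : L (- u) = - L u by rewrite -scaleN1r LZ scaleN1r.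
have ker0 w : L w = 0 -> ev h w = 0.
  move=> Lw.
  have := hN (w0 + w); have := hN (w0 - w).
  rewrite /preimage /= !LD LN Lw oppr0 !addr0 => /(_ Ow0) + /(_ Ow0).
  by rewrite evB evD; lra.
have hSL w : ev h w = ev h (S (L w)).
  by apply/eqP; rewrite -subr_eq0 -evB; apply/eqP/ker0; rewrite LD LN SK subrr.
split=> //; apply/normal_coneP => v Ov.
have := hN (S v); rewrite /preimage /= SK => /(_ Ov).
by rewrite (hSL w0).
Qed.

Lemma flat_normal_cone_preimage Om w0 : Om (L w0) ->
  flat_normal_cone Om (L w0) -> flat_normal_cone (L @^-1` Om) w0.
Proof.
move=> Ow0 flat h /(normal_cone_preimage Ow0)[hN hSL] w Ow.
by rewrite hSL (hSL w0); exact: (flat _ hN).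
Qed.

End Cylinder.

(** * Coderivatives *)

Section Coderivative.
Context {R : realType} {X Y : tvsType R}.

Lemma coderivativeP (F : X -> set Y) x y (ys : dual Y) (xs : dual X) :
  coderivative F x y ys xs <->
  forall x' y', F x' y' -> ev xs x' - ev ys y' <= ev xs x - ev ys y.
Proof.
split=> [/normal_coneP H x' y' Fxy|H]; first exact: (H (x', y')).
by apply/normal_coneP => -[x' y']; exact: H.
Qed.

End Coderivative.

Lemma continuous_pair (T U V : topologicalType) (f : T -> U) (g : T -> V) :
  continuous f -> continuous g -> continuous (fun x => (f x, g x)).
Proof. by move=> cf cg x; exact: (cvg_pair (cf x) (cg x)). Qed.

Section Composition.
Context {R : realType} {X Y Z : tvsType R}.
Implicit Types (F : X -> set Y) (G : Y -> set Z).

(** [drop_fst] and [fst] cut out the cylinders over gph G and gph F; the two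
    paddings are the continuous linear sections along which normal functionals
    to these cylinders descend. *)
Definition drop_fst (w : X * Y * Z) : Y * Z := (w.1.2, w.2).
Definition pad_fst (v : Y * Z) : X * Y * Z := (0, v.1, v.2).
Definition pad_snd (v : X * Y) : X * Y * Z := (v, 0).

Fact fst_linear : linear (fst : X * Y * Z -> X * Y). Proof. by []. Qed.

Fact drop_fst_linear : linear drop_fst. Proof. by []. Qed.

Fact pad_fst_linear : linear pad_fst.
Proof.
by move=> a u v; apply/eqP; rewrite !xpair_eqE/= scaler0 addr0 !eqxx.
Qed.

Fact pad_snd_linear : linear pad_snd.
Proof.
by move=> a u v; apply/eqP; rewrite !xpair_eqE/= scaler0 addr0 !eqxx.
Qed.

Fact fst_continuous : continuous (fst : X * Y * Z -> X * Y).
Proof. by move=> w; exact: cvg_fst. Qed.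

Fact drop_fst_continuous : continuous drop_fst.
Proof.
apply: continuous_pair => w; last exact: cvg_snd.
by apply: (@continuous_comp _ _ _ fst snd); [exact: cvg_fst|exact: cvg_snd].
Qed.

Fact pad_fst_continuous : continuous pad_fst.
Proof.
apply: continuous_pair; last by move=> w; exact: cvg_snd.
by apply: continuous_pair => w; [exact: cvg_cst|exact: cvg_fst].
Qed.

Fact pad_snd_continuous : continuous pad_snd.
Proof. by apply: continuous_pair => w; [exact: cvg_id|exact: cvg_cst]. Qed.

Fact pad_fstK : cancel pad_fst drop_fst. Proof. by case. Qed.

Fact pad_sndK : cancel pad_snd fst. Proof. by []. Qed.

(** h1 is independent of z and h2 of x, so evaluating h1 + h2 along the axes
    gives h1 = xs along X, h2 = - zs along Z and h1 = - h2 along Y.  The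
    intermediate functional ys is the restriction of h2 to Y. *)
Lemma coderivative_comp_split F G xb yb zb (xs : dual X) (zs : dual Z) :
    F xb yb -> G yb zb ->
    (exists h1 h2 : dual (X * Y * Z)%type,
      [/\ normal_cone (xb, yb, zb) (fst @^-1` gph F) h1,
          normal_cone (xb, yb, zb) (drop_fst @^-1` gph G) h2 &
          forall w, ev xs w.1.1 - ev zs w.2 = ev h1 w + ev h2 w]) ->
  sv_comp (coderivative F xb yb) (coderivative G yb zb) zs xs.
Proof.
move=> Fxy Gyz [h1 [h2 [N1 N2 hE]]].
have [{}N1 h1E] := normal_cone_preimage fst_linear pad_snd_linear
  pad_snd_continuous pad_sndK (w0 := (xb, yb, zb)) Fxy N1.
have [{}N2 h2E] := normal_cone_preimage drop_fst_linear pad_fst_linear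
  pad_fst_continuous pad_fstK (w0 := (xb, yb, zb)) Gyz N2.
have ins_lin : linear (fun y : Y => pad_fst (y, 0)).
  move=> a u v; rewrite -pad_fst_linear; congr pad_fst.
  by apply/eqP; rewrite !xpair_eqE/= scaler0 addr0 !eqxx.
have ins_cont : continuous (fun y : Y => pad_fst (y, 0)).
  apply: continuous_pair; last by move=> y; exact: cvg_cst.
  by apply: continuous_pair => y; [exact: cvg_cst|exact: cvg_id].
have h2z z : ev h2 (0, 0, z) = - ev zs z.
  have := hE (0, 0, z); rewrite /= (h1E (0, 0, z)) /pad_snd /=.
  by rewrite !ev0; lra.
have h1x x : ev h1 (x, 0, 0) = ev xs x.
  have := hE (x, 0, 0); rewrite /= (h2E (x, 0, 0)) /pad_fst /=.
  by rewrite !ev0; lra.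
have h12 y : ev h1 (0, y, 0) + ev h2 (0, y, 0) = 0.
  by rewrite -hE /= !ev0 subrr.
exists (dual_pull ins_lin ins_cont h2).
  apply/coderivativeP => y z Gv.
  have E y' z' : ev (dual_pull ins_lin ins_cont h2) y' - ev zs z' =
      ev (dual_pull pad_fst_linear pad_fst_continuous h2) (y', z').
    rewrite -h2z.
    change (ev h2 (0, y', 0) + ev h2 (0, 0, z') = ev h2 (0, y', z')).
    by rewrite -evD; congr (ev h2 (_, _, _)); rewrite ?addr0 ?add0r.
  by rewrite !E; exact: (proj1 (normal_coneP _ _ _) N2 (y, z) Gv).
apply/coderivativeP => x y Fv.
have E x' y' : ev xs x' - ev (dual_pull ins_lin ins_cont h2) y' =
    ev (dual_pull pad_snd_linear pad_snd_continuous h1) (x', y').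
  change (ev xs x' - ev h2 (0, y', 0) = ev h1 (x', y', 0)).
  have -> : (x', y', 0) = (x', 0, 0) + (0, y', 0) :> X * Y * Z.
    by congr (_, _, _); rewrite ?addr0 ?add0r.
  by rewrite evD h1x; have := h12 y'; lra.
by rewrite !E; exact: (proj1 (normal_coneP _ _ _) N1 (x, y) Fv).
Qed.

End Composition.

Theorem theorem5p7 (R : realType) (X Y Z : tvsType R)
    (F : X -> set Y) (G : Y -> set Z)
    (convF : sv_convex F) (convG : sv_convex G)
    (qualification :
      (sv_polyhedral F /\
        exists (xh : X) (yh : Y) (zh : Z),
          gph F (xh, yh) /\ qri (gph G) (yh, zh)) \/
      (sv_polyhedral G /\
        exists (xh : X) (yh : Y) (zh : Z),
          qri (gph F) (xh, yh) /\ gph G (yh, zh)))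
    (xb : X) (zb : Z) (xzb : gph (sv_comp G F) (xb, zb))
    (zstar : dual Z) (yb : Y) (yM : (F xb `&` sv_inv G zb) yb) :
  coderivative (sv_comp G F) xb zb zstar =
  sv_comp (coderivative F xb yb) (coderivative G yb zb) zstar.
Proof.
case: yM => Fb Gb; apply/seteqP; split=> xs; last first.
  move=> [ys /coderivativeP GN /coderivativeP FN].
  apply/coderivativeP => x z [y Fxy Gyz].
  by have := GN _ _ Gyz; have := FN _ _ Fxy; lra.
move=> /coderivativeP N; apply: coderivative_comp_split => //.
have fst2_lin : linear (fun w : X * Y * Z => w.1.1) by [].
have fst2_cont : continuous (fun w : X * Y * Z => w.1.1).
  by move=> w; apply: (@continuous_comp _ _ _ fst fst); exact: cvg_fst.
have snd_lin : linear (fun w : X * Y * Z => w.2) by [].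
have snd_cont : continuous (fun w : X * Y * Z => w.2).
  by move=> w; exact: cvg_snd.
pose g := dual_comb (-1) (dual_pull fst2_lin fst2_cont xs)
                         (dual_pull snd_lin snd_cont zstar).
have gE w : ev g w = ev xs w.1.1 - ev zstar w.2 by rewrite ev_comb mulN1r.
have gN : normal_cone (xb, yb, zb)
    ((fst @^-1` gph F) `&` (drop_fst @^-1` gph G)) g.
  apply/normal_coneP => -[[x y] z] [/= Fxy Gyz]; rewrite !gE.
  by apply: N; exists y.
case: qualification => -[poly [xh [yh [zh [Fh Gh]]]]].
- have pF := convex_polyhedron_preimage fst_linear
    (@fst_continuous _ X Y Z) poly.
  have cG := convex_preimage (@drop_fst_linear _ X Y Z) convG.
  have GhE : gph G (drop_fst (xh, yh, zh)) by case: Gh.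
  have flatG := flat_normal_cone_preimage drop_fst_linear pad_fst_linear
    pad_fst_continuous pad_fstK GhE (qri_flat_normal_cone Gh).
  have [h1 [h2 [N1 N2 hE]]] :=
    normal_cone_polyhedronI (w0 := (xh, yh, zh)) (w := (xb, yb, zb))
      pF cG Fh GhE flatG Fb Gb gN.
  by exists h1, h2; split=> // w; rewrite -gE hE.
- have pG := convex_polyhedron_preimage drop_fst_linear
    (@drop_fst_continuous _ X Y Z) poly.
  have cF := convex_preimage (@fst_linear _ X Y Z) convF.
  have FhE : gph F (xh, yh, zh).1 by case: Fh.
  have flatF := flat_normal_cone_preimage fst_linear pad_snd_linear
    pad_snd_continuous pad_sndK FhE (qri_flat_normal_cone Fh).
  rewrite setIC in gN.
  have [h2 [h1 [N2 N1 hE]]] :=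
    normal_cone_polyhedronI (w0 := (xh, yh, zh)) (w := (xb, yb, zb))
      pG cF Gh FhE flatF Gb Fb gN.
  by exists h1, h2; split=> // w; rewrite -gE hE addrC.
Qed.
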